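(* Let $(S,\mathfrak n)$ be a commutative noetherian local ring and let $\omega\in\mathfrak n$ be a non-zerodivisor. Then the additive category $\mathsf{Mon}(\omega,\mathcal G)$, endowed with the class of those short exact sequences in $\mathsf{Mor}(S)$ all of whose terms lie in $\mathsf{Mon}(\omega,\mathcal G)$ as conflations, is an exact category in the sense of Quillen.
   Context: All modules are finitely generated. A finitely generated $S$-module $M$ is Gorenstein projective if $\mathrm{Ext}^i_S(M,S)=0=\mathrm{Ext}^i_S(\mathrm{Hom}_S(M,S),S)$ for all $i\ge 1$ and the biduality map $M\to \mathrm{Hom}_S(\mathrm{Hom}_S(M,S),S)$ is an isomorphism; $\mathcal G(S)$ is the category of finitely generated Gorenstein projective $S$-modules. $\mathsf{Mor}(S)$ is the morphism category of finitely generated $S$-modules (objects: $S$-homomorphisms $(M_1\xrightarrow{f}M_0)$; morphisms: commutative squares); short exact sequences in it are the componentwise exact ones. $\mathsf{Mon}(\omega,\mathcal G)$ is the full subcategory of $\mathsf{Mor}(S)$ whose objects are the injective $S$-homomorphisms $(G_1\xrightarrow{f}G_0)$ with $G_1,G_0\in\mathcal G(S)$ and $\omega\,\mathrm{Coker} f=0$; a morphism $(G_1\xrightarrow{f}G_0)\to(G'_1\xrightarrow{f'}G'_0)$ is a pair $(\varphi_1,\varphi_0)$ with $f'\varphi_1=\varphi_0 f$. An exact category is an additive category $\mathcal C$ with a class $\mathcal E$ (closed under isomorphism) of kernel-cokernel pairs $(i,p)$, called conflations; $i$ is then called an admissible monic and $p$ an admissible epic. The axioms are: identities are admissible monics and admissible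 epics; admissible monics (resp. epics) are closed under composition; the push-out of an admissible monic along any morphism exists and yields an admissible monic; the pull-back of an admissible epic along any morphism exists and yields an admissible epic. *)

(* Defs.v *)
From HB Require Import structures.
From mathcomp Require Import all_boot all_algebra.
From mathcomp Require Import boolp classical_sets.

Set Implicit Arguments.
Unset Strict Implicit.
Unset Printing Implicit Defensive.

Import GRing.Theory.
Local Open Scope ring_scope.

Section Rings.
Variable S : comNzRingType.

Definition ideal (I : set S) : Prop :=
  [/\ I 0, forall x y, I x -> I y -> I (x + y) & forall a x, I x -> I (a * x)].

Definition maximal_ideal (m : set S) : Prop :=
  [/\ ideal m, ~ m 1
    & forall J, ideal J -> ~ J 1 -> (m `<=` J)%classic -> J = m].

Definition local_ring (m : set S) : Prop :=
  maximal_ideal m /\ forall m', maximal_ideal m' -> m' = m.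

Definition noetherian_ring : Prop :=
  forall I : set S, ideal I ->
    exists (k : nat) (g : 'I_k -> S), forall x,
      I x <-> exists c : 'I_k -> S, x = \sum_(i < k) c i * g i.

End Rings.

Definition finitely_generated (S : pzRingType) (M : lmodType S) : Prop :=
  exists (k : nat) (g : 'I_k -> M), forall x,
    exists c : 'I_k -> S, x = \sum_(i < k) c i *: g i.

Lemma linear_ext (S : pzRingType) (U V : lmodType S) (f g : {linear U -> V}) :
  f =1 g -> f = g.
Proof.
move: f g => [f [[fn] [fs]]] [g [[gn] [gs]]] /= /funext fg.
move: fn fs gn gs; rewrite fg => fn fs gn gs.
by rewrite (Prop_irrelevance fn gn) (Prop_irrelevance fs gs).
Qed.

Section LinearZmodule.
Variables (S : pzRingType) (U V : lmodType S).
Local Notation hom := {linear U -> V}.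

HB.instance Definition _ := gen_eqMixin hom.
HB.instance Definition _ := gen_choiceMixin hom.

Let zero : hom := \0.
Let opp (f : hom) : hom := \- f.
Let add (f g : hom) : hom := f \+ g.

Fact linear_addA : associative add.
Proof. by move=> f g h; apply: linear_ext => x /=; rewrite addrA. Qed.
Fact linear_addC : commutative add.
Proof. by move=> f g; apply: linear_ext => x /=; rewrite addrC. Qed.
Fact linear_add0 : left_id zero add.
Proof. by move=> f; apply: linear_ext => x /=; rewrite add0r. Qed.
Fact linear_addN : left_inverse zero opp add.
Proof. by move=> f; apply: linear_ext => x /=; rewrite addNr. Qed.

HB.instance Definition _ :=
  GRing.isZmodule.Build hom linear_addA linear_addC linear_add0 linear_addN.

End LinearZmodule.

Section LinearLmodule.
Variables (S : comNzRingType) (U V : lmodType S).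
Local Notation hom := {linear U -> V}.

Let scale (a : S) (f : hom) : hom := a \*: f.

Fact linear_scaleA a b f : scale a (scale b f) = scale (a * b) f.
Proof. by apply: linear_ext => x /=; rewrite scalerA. Qed.
Fact linear_scale1 : left_id 1 scale.
Proof. by move=> f; apply: linear_ext => x /=; rewrite scale1r. Qed.
Fact linear_scaleDr : right_distributive scale +%R.
Proof. by move=> a f g; apply: linear_ext => x /=; rewrite scalerDr. Qed.
Fact linear_scaleDl f : {morph scale^~ f : a b / a + b}.
Proof. by move=> a b; apply: linear_ext => x /=; rewrite scalerDl. Qed.

HB.instance Definition _ := GRing.Zmodule_isLmodule.Build S hom
  linear_scaleA linear_scale1 linear_scaleDr linear_scaleDl.

End LinearLmodule.

Section Modules.
Variable S : comNzRingType.
Implicit Types M N : lmodType S.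

Definition surjective (A B : Type) (f : A -> B) : Prop :=
  forall y, exists x, f x = y.

Definition exact_at (M N P : lmodType S) (f : {linear M -> N})
    (g : {linear N -> P}) : Prop :=
  forall y, g y = 0 <-> exists x, f x = y.

Definition short_exact_mod (M N P : lmodType S) (f : {linear M -> N})
    (g : {linear N -> P}) : Prop :=
  [/\ injective f, exact_at f g & surjective g].

Definition projective (P : lmodType S) : Prop :=
  forall (M N : lmodType S) (g : {linear M -> N}) (f : {linear P -> N}),
    surjective g -> exists h : {linear P -> M}, g \o h =1 f.

Record projective_resolution M := ProjectiveResolution {
  res_mod : nat -> lmodType S;
  res_diff : forall i, {linear res_mod i.+1 -> res_mod i};
  res_aug : {linear res_mod 0 -> M};
  res_proj : forall i, projective (res_mod i);
  res_aug_surj : surjective res_aug;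
  res_exact0 : exact_at (res_diff 0) res_aug;
  res_exact : forall i, exact_at (res_diff i.+1) (res_diff i)
}.

(* Cocycles and coboundaries of degree i in the complex Hom_S(P, N). *)
Definition cocycle M (P : projective_resolution M) N (i : nat)
    (f : {linear res_mod P i -> N}) : Prop :=
  f \o res_diff P i =1 \0.

Definition coboundary M (P : projective_resolution M) N (i : nat) :
    {linear res_mod P i -> N} -> Prop :=
  match i with
  | 0 => fun f => f =1 \0
  | j.+1 => fun f =>
      exists g : {linear res_mod P j -> N}, f =1 g \o res_diff P j
  end.

(* Ext^i_S(M, N) = 0, where Ext^i_S(M, N) is the i-th cohomology of
   Hom_S(P, N) for a chosen projective resolution P of M. Up to isomorphism
   this cohomology does not depend on P. *)
Definition Ext_eq0 (i : nat) M N : Prop :=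
  exists P : projective_resolution M,
    forall f : {linear res_mod P i -> N}, cocycle f -> coboundary f.

Definition dual M : lmodType S := {linear M -> S^o}.

Section Biduality.
Variable M : lmodType S.

Definition eval_at (x : M) (f : dual M) : S^o :=
  (f : {linear M -> S^o}) x.

Fact eval_at_is_linear x : linear (eval_at x).
Proof. by []. Qed.
HB.instance Definition _ x :=
  GRing.isLinear.Build S (dual M) S^o *:%R (eval_at x) (eval_at_is_linear x).

Definition biduality (x : M) : dual (dual M) :=
  (eval_at x : {linear dual M -> S^o}).

Fact biduality_is_linear : linear biduality.
Proof.
move=> a x y; apply: linear_ext => f.
by rewrite /= /eval_at linearP.
Qed.
HB.instance Definition _ :=
  GRing.isLinear.Build S M (dual (dual M)) *:%R biduality biduality_is_linear.

End Biduality.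

Definition gorenstein_projective M : Prop :=
  [/\ finitely_generated M,
      forall i, (1 <= i)%N -> Ext_eq0 i M S^o,
      forall i, (1 <= i)%N -> Ext_eq0 i (dual M) S^o
    & bijective (@biduality M)].

End Modules.

Record preadditive_category := PreadditiveCategory {
  cat_obj :> Type;
  cat_hom : cat_obj -> cat_obj -> zmodType;
  cat_id : forall A, cat_hom A A;
  cat_comp : forall A B C, cat_hom B C -> cat_hom A B -> cat_hom A C;
  cat_compA : forall A B C D (h : cat_hom C D) (g : cat_hom B C)
    (f : cat_hom A B), cat_comp h (cat_comp g f) = cat_comp (cat_comp h g) f;
  cat_comp1f : forall A B (f : cat_hom A B), cat_comp (cat_id B) f = f;
  cat_compf1 : forall A B (f : cat_hom A B), cat_comp f (cat_id A) = f;
  cat_compDl : forall A B C (g g' : cat_hom B C) (f : cat_hom A B),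
    cat_comp (g + g') f = cat_comp g f + cat_comp g' f;
  cat_compDr : forall A B C (g : cat_hom B C) (f f' : cat_hom A B),
    cat_comp g (f + f') = cat_comp g f + cat_comp g f'
}.

Arguments cat_hom {_} _ _.
Arguments cat_id {_} _.
Arguments cat_comp {_ _ _ _} _ _.

Reserved Notation "g \oc f" (at level 40, left associativity).
Notation "g \oc f" := (cat_comp g f) : ring_scope.

Section Categories.
Variable C : preadditive_category.
Implicit Types A B X Y Z : C.

Definition zero_object Z : Prop :=
  forall A, (forall f : cat_hom A Z, f = 0) /\ (forall f : cat_hom Z A, f = 0).

Definition biproduct A B P (i1 : cat_hom A P) (i2 : cat_hom B P)
    (p1 : cat_hom P A) (p2 : cat_hom P B) : Prop :=
  [/\ p1 \oc i1 = cat_id A, p2 \oc i2 = cat_id B, p1 \oc i2 = 0,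
      p2 \oc i1 = 0 & i1 \oc p1 + i2 \oc p2 = cat_id P].

Definition additive_category : Prop :=
  (exists Z, zero_object Z) /\
  (forall A B, exists P i1 i2 p1 p2, @biproduct A B P i1 i2 p1 p2).

Definition isomorphism A B (f : cat_hom A B) : Prop :=
  exists g : cat_hom B A, g \oc f = cat_id A /\ f \oc g = cat_id B.

Definition is_kernel A B X (i : cat_hom A B) (p : cat_hom B X) : Prop :=
  p \oc i = 0 /\
  forall T (t : cat_hom T B), p \oc t = 0 ->
    exists! u : cat_hom T A, i \oc u = t.

Definition is_cokernel A B X (i : cat_hom A B) (p : cat_hom B X) : Prop :=
  p \oc i = 0 /\
  forall T (t : cat_hom B T), t \oc i = 0 ->
    exists! u : cat_hom X T, u \oc p = t.

Definition kernel_cokernel_pair A B X (i : cat_hom A B) (p : cat_hom B X) :=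
  is_kernel i p /\ is_cokernel i p.

Definition is_pushout A B A' B' (i : cat_hom A B) (f : cat_hom A A')
    (i' : cat_hom A' B') (f' : cat_hom B B') : Prop :=
  i' \oc f = f' \oc i /\
  forall T (s : cat_hom A' T) (t : cat_hom B T), s \oc f = t \oc i ->
    exists! u : cat_hom B' T, u \oc i' = s /\ u \oc f' = t.

Definition is_pullback B X B' X' (p : cat_hom B X) (f : cat_hom X' X)
    (p' : cat_hom B' X') (f' : cat_hom B' B) : Prop :=
  f \oc p' = p \oc f' /\
  forall T (s : cat_hom T X') (t : cat_hom T B), f \oc s = p \oc t ->
    exists! u : cat_hom T B', p' \oc u = s /\ f' \oc u = t.

Variable E : forall A B X, cat_hom A B -> cat_hom B X -> Prop.

Definition admissible_monic A B (i : cat_hom A B) : Prop :=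
  exists X (p : cat_hom B X), E i p.

Definition admissible_epic B X (p : cat_hom B X) : Prop :=
  exists A (i : cat_hom A B), E i p.

Definition iso_closed : Prop :=
  forall A B X A' B' X' (i : cat_hom A B) (p : cat_hom B X)
      (i' : cat_hom A' B') (p' : cat_hom B' X')
      (a : cat_hom A A') (b : cat_hom B B') (x : cat_hom X X'),
    isomorphism a -> isomorphism b -> isomorphism x ->
    i' \oc a = b \oc i -> p' \oc b = x \oc p -> E i p -> E i' p'.

Record exact_category : Prop := ExactCategory {
  exact_additive : additive_category;
  exact_kercoker : forall A B X (i : cat_hom A B) (p : cat_hom B X),
    E i p -> kernel_cokernel_pair i p;
  exact_iso_closed : iso_closed;
  exact_monic_id : forall A, admissible_monic (cat_id A);
  exact_epic_id : forall A, admissible_epic (cat_id A);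
  exact_monic_comp : forall A B X (i : cat_hom A B) (j : cat_hom B X),
    admissible_monic i -> admissible_monic j -> admissible_monic (j \oc i);
  exact_epic_comp : forall A B X (p : cat_hom A B) (q : cat_hom B X),
    admissible_epic p -> admissible_epic q -> admissible_epic (q \oc p);
  exact_pushout : forall A B A' (i : cat_hom A B) (f : cat_hom A A'),
    admissible_monic i ->
    exists B' (i' : cat_hom A' B') (f' : cat_hom B B'),
      is_pushout i f i' f' /\ admissible_monic i';
  exact_pullback : forall B X X' (p : cat_hom B X) (f : cat_hom X' X),
    admissible_epic p ->
    exists B' (p' : cat_hom B' X') (f' : cat_hom B' B),
      is_pullback p f p' f' /\ admissible_epic p'
}.

End Categories.

Definition full_subcategory (C : preadditive_category) (P : C -> Prop) :
    preadditive_category :=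
  @PreadditiveCategory {X : C | P X} (fun X Y => cat_hom (sval X) (sval Y))
    (fun X => cat_id (sval X)) (fun _ _ _ g f => g \oc f)
    (fun _ _ _ _ => @cat_compA C _ _ _ _)
    (fun _ _ => @cat_comp1f C _ _) (fun _ _ => @cat_compf1 C _ _)
    (fun _ _ _ => @cat_compDl C _ _ _) (fun _ _ _ => @cat_compDr C _ _ _).

Section MorphismCategory.
Variable S : comNzRingType.

Record mor_obj := MorObj {
  mor_dom : lmodType S;
  mor_cod : lmodType S;
  mor_map :> {linear mor_dom -> mor_cod};
  mor_dom_fg : finitely_generated mor_dom;
  mor_cod_fg : finitely_generated mor_cod
}.

Record mor_hom (X Y : mor_obj) := MorHom {
  hom_dom : {linear mor_dom X -> mor_dom Y};
  hom_cod : {linear mor_cod X -> mor_cod Y};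
  hom_comm : Y \o hom_dom =1 hom_cod \o X
}.

Lemma mor_hom_ext X Y (a b : mor_hom X Y) :
  hom_dom a =1 hom_dom b -> hom_cod a =1 hom_cod b -> a = b.
Proof.
case: a b => [a1 a0 ca] [b1 b0 cb] /= /linear_ext e1 /linear_ext e0.
by move: ca cb; rewrite e1 e0 => ca cb; congr MorHom; exact: Prop_irrelevance.
Qed.

Section HomZmodule.
Variables X Y : mor_obj.
Local Notation hom := (mor_hom X Y).

HB.instance Definition _ := gen_eqMixin hom.
HB.instance Definition _ := gen_choiceMixin hom.

Let zero : hom.
Proof. by exists 0 0 => x /=; rewrite linear0. Defined.
Let opp (a : hom) : hom.
Proof.
exists (- hom_dom a) (- hom_cod a) => x /=.
by rewrite linearN; congr (- _); exact: hom_comm.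
Defined.
Let add (a b : hom) : hom.
Proof.
exists (hom_dom a + hom_dom b) (hom_cod a + hom_cod b) => x /=.
by rewrite linearD; congr (_ + _); exact: hom_comm.
Defined.

Fact mor_addA : associative add.
Proof. by move=> a b c; apply: mor_hom_ext => x /=; rewrite addrA. Qed.
Fact mor_addC : commutative add.
Proof. by move=> a b; apply: mor_hom_ext => x /=; rewrite addrC. Qed.
Fact mor_add0 : left_id zero add.
Proof. by move=> a; apply: mor_hom_ext => x /=; rewrite add0r. Qed.
Fact mor_addN : left_inverse zero opp add.
Proof. by move=> a; apply: mor_hom_ext => x /=; rewrite addNr. Qed.

HB.instance Definition _ :=
  GRing.isZmodule.Build hom mor_addA mor_addC mor_add0 mor_addN.

End HomZmodule.

Definition mor_id (X : mor_obj) : mor_hom X X := @MorHom X X idfun idfun (frefl _).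

Definition mor_comp (X Y Z : mor_obj) (b : mor_hom Y Z) (a : mor_hom X Y) :
  mor_hom X Z.
Proof.
exists (hom_dom b \o hom_dom a) (hom_cod b \o hom_cod a) => x /=.
by have /= <- := hom_comm a x; exact: hom_comm.
Defined.

Definition Mor : preadditive_category.
Proof.
exists mor_obj mor_hom mor_id mor_comp.
- by move=> *; apply: mor_hom_ext.
- by move=> *; apply: mor_hom_ext.
- by move=> *; apply: mor_hom_ext.
- by move=> *; apply: mor_hom_ext.
- by move=> X Y Z c a b; apply: mor_hom_ext => x /=; rewrite linearD.
Defined.

Definition mor_short_exact (X Y Z : Mor) (a : cat_hom X Y) (b : cat_hom Y Z) :
    Prop :=
  short_exact_mod (hom_dom a) (hom_dom b) /\
  short_exact_mod (hom_cod a) (hom_cod b).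

Variable w : S.

(* The last clause says that w annihilates mor_cod X / im X. *)
Definition in_Mon (X : Mor) : Prop :=
  [/\ gorenstein_projective (mor_dom X), gorenstein_projective (mor_cod X),
      injective (mor_map X)
    & forall y : mor_cod X, exists x : mor_dom X, mor_map X x = w *: y].

Definition Mon : preadditive_category := full_subcategory in_Mon.

Definition Mon_conflation (X Y Z : Mon) (i : cat_hom X Y) (p : cat_hom Y Z) :
    Prop :=
  @mor_short_exact (sval X) (sval Y) (sval Z) i p.

End MorphismCategory.

(* Main.v *)
Require Import Defs.
From HB Require Import structures.
From mathcomp Require Import all_boot all_algebra.
From mathcomp Require Import boolp classical_sets.

(* Everything reduces to the closure of Gorenstein projectives under extensions.
   Let 0 -> A -> B -> C -> 0 be exact with A and C Gorenstein projective. A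
   horseshoe resolution shows Ext^n(B, S) = 0; as Ext^1(C, S) = 0, the dual
   sequence 0 -> C^* -> B^* -> A^* -> 0 is exact, so the same argument gives
   Ext^n(B^*, S) = 0. Dualizing once more, biduality maps the original sequence
   to its exact bidual, and the short five lemma applies to it.
   Pullbacks of admissible epics and pushouts of admissible monics, taken
   componentwise in Mor(S), have components that are such extensions, and so
   do the kernels (resp. cokernels) of composites. The injectivity of the
   resulting objects and the condition on w follow by diagram chasing. *)

Set Implicit Arguments.
Unset Strict Implicit.
Unset Printing Implicit Defensive.

Import GRing.Theory.
Local Open Scope ring_scope.

(** * Linear maps, kernels and cokernels *)

Section LinearMaps.
Variable S : comNzRingType.
Implicit Types M N P U V T : lmodType S.

Lemma linear_map_of U V (f : U -> V) :
  linear f -> exists g : {linear U -> V}, g =1 f.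
Proof.
move=> lf.
pose g : {linear U -> V} :=
  HB.pack f (GRing.isLinear.Build S U V *:%R f lf).
by exists g.
Qed.

(** A map may be given by its graph: two values at one point differ by a value at [0], so [R] is
    single-valued, and a choice function for it is linear. Lifts, factorisations and the universal
    maps of pushouts and pullbacks are built this way. *)
Lemma linear_relation U V (R : U -> V -> Prop) :
    (forall x, exists y, R x y) -> (forall y, R 0 y -> y = 0) ->
    (forall a x x' y y', R x y -> R x' y' -> R (a *: x + x') (a *: y + y')) ->
  exists f : {linear U -> V}, forall x y, R x y -> f x = y.
Proof.
move=> /choice[f Rf] R0 Rlin.
have Runiq x y y' : R x y -> R x y' -> y = y'.
  move=> Rxy /(Rlin (-1) _ _ _ _ Rxy).
  by rewrite !scaleN1r addNr addrC => /R0/subr0_eq.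
have [|g gf] := @linear_map_of _ _ f.
  by move=> a x y; apply: (Runiq _ _ _ (Rf _)); apply: Rlin.
by exists g => x y; rewrite gf; apply: Runiq.
Qed.

Lemma linear_inj U V (f : {linear U -> V}) :
  (forall x, f x = 0 -> x = 0) -> injective f.
Proof. exact: raddf_inj. Qed.

Lemma lift_injective M N T (i : {linear M -> N}) (t : {linear T -> N}) :
    injective i -> (forall x, exists y, i y = t x) ->
  exists u : {linear T -> M}, forall x, i (u x) = t x.
Proof.
move=> i_inj it.
have [||a x x' y y' /= ix ix'|u uP] := @linear_relation _ _ (fun x y => i y = t x).
- exact: it.
- by move=> y; rewrite linear0 -(linear0 i) => /i_inj.
- by rewrite !linearP ix ix'.
- by exists u => x; have [y iy] := it x; rewrite (uP _ _ iy).
Qed.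

Lemma factor_surjective M N T (p : {linear M -> N}) (t : {linear M -> T}) :
    surjective p -> (forall x, p x = 0 -> t x = 0) ->
  exists u : {linear N -> T}, forall x, u (p x) = t x.
Proof.
move=> p_surj pt.
have [x|y|a x x' y y'|u uP] :=
  @linear_relation _ _ (fun x y => exists2 z, p z = x & t z = y).
- by have [z pz] := p_surj x; exists (t z), z.
- by case=> z /pt -> ->.
- move=> [z <- <-] [z' <- <-]; exists (a *: z + z'); exact: linearP.
- by exists u => x; apply: uP; exists x.
Qed.

Lemma linear_row M N T (f : {linear M -> T}) (g : {linear N -> T}) :
  exists h : {linear (M * N)%type -> T}, forall x, h x = f x.1 + g x.2.
Proof.
apply: linear_map_of => a x y /=.
by rewrite !linearP scalerDr addrACA.
Qed.

Lemma linear_col M N T (f : {linear T -> M}) (g : {linear T -> N}) :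
  exists h : {linear T -> (M * N)%type}, forall x, h x = (f x, g x).
Proof. by apply: linear_map_of => a x y; rewrite !linearP. Qed.

End LinearMaps.

(** * Kernels as submodules *)

Section Kernel.
Variables (S : comNzRingType) (M N : lmodType S) (f : {linear M -> N}).

Definition ker_pred : pred M := fun x => f x == 0.

Fact ker_pred_submod : submod_closed ker_pred.
Proof.
split=> [|a x y]; rewrite !unfold_in /ker_pred ?linear0 //.
by move=> /eqP fx /eqP fy; rewrite linearP fx fy scaler0 addr0.
Qed.

HB.instance Definition _ := GRing.isSubmodClosed.Build S M ker_pred ker_pred_submod.

Definition ker_mod := {x : M | ker_pred x}.
HB.instance Definition _ := SubType.on ker_mod.
HB.instance Definition _ := Choice.on ker_mod.
HB.instance Definition _ := [SubChoice_isSubLmodule of ker_mod by <:].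

Lemma kernel_exists :
  exists (K : lmodType S) (i : {linear K -> M}), injective i /\ exact_at i f.
Proof.
exists ker_mod, (val : {linear ker_mod -> M}); split; first exact: val_inj.
move=> y; split => [/eqP fy|[x <-]]; first by exists (exist _ y fy).
by apply/eqP; exact: (valP x).
Qed.

End Kernel.

(** * Cokernels as quotient modules *)

Section Cokernel.
Variables (S : comNzRingType) (M N : lmodType S) (f : {linear M -> N}).

Definition im_pred : pred N := fun y => `[< exists x, f x = y >].

Fact im_pred_submod : submod_closed im_pred.
Proof.
split=> [|a x y]; rewrite !unfold_in /im_pred.
  by apply/asboolP; exists 0; rewrite linear0.
move=> /asboolP[x' <-] /asboolP[y' <-].
by apply/asboolP; exists (a *: x' + y'); rewrite linearP.
Qed.

HB.instance Definition _ := GRing.isSubmodClosed.Build S N im_pred im_pred_submod.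

(** At first only the additive quotient of [N] by the image of [f]; the action of [S] is put on it
    through [coker_scale]. *)
Definition coker_mod := @Quotient.quot N (GRing.ZmodClosed.clone N im_pred _).
HB.instance Definition _ := EqQuotient.on coker_mod.
HB.instance Definition _ := GRing.Zmodule.on coker_mod.

Local Notation pi := (\pi_coker_mod%qT : N -> coker_mod).

Lemma coker_piE x y : (pi x = pi y) <-> im_pred (x - y).
Proof.
split=> [e|h]; first by have /eqP := e; rewrite -Quotient.idealrBE.
by apply/eqP; rewrite -Quotient.idealrBE.
Qed.

Lemma coker_piD : {morph pi : x y / x + y}.
Proof.
by move=> x y; rewrite (@Quotient.pi_add N (GRing.ZmodClosed.clone N im_pred _)).
Qed.

Definition coker_scale (a : S) (x : coker_mod) : coker_mod := pi (a *: repr x).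

(** The choice of representative does not matter because the image of [f] is closed under scalars.
    The module axioms are then inherited from [N]. *)
Lemma coker_scaleE a x : coker_scale a (pi x) = pi (a *: x).
Proof.
have /coker_piE/asboolP[z zE] : pi (repr (pi x)) = pi x by rewrite reprK.
by apply/(coker_piE (a *: _))/asboolP; exists (a *: z); rewrite linearZ /= zE scalerBr.
Qed.

Lemma coker_piP v : exists x, pi x = v.
Proof. by exists (repr v); rewrite reprK. Qed.

Fact coker_scaleA a b v : coker_scale a (coker_scale b v) = coker_scale (a * b) v.
Proof. by have [x <-] := coker_piP v; rewrite !coker_scaleE scalerA. Qed.
Fact coker_scale1 : left_id 1 coker_scale.
Proof. by move=> v; have [x <-] := coker_piP v; rewrite coker_scaleE scale1r. Qed.
Fact coker_scaleDr : right_distributive coker_scale +%R.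
Proof.
move=> a u v; have [x <-] := coker_piP u; have [y <-] := coker_piP v.
by rewrite -coker_piD !coker_scaleE scalerDr coker_piD.
Qed.
Fact coker_scaleDl v : {morph coker_scale^~ v : a b / a + b}.
Proof.
move=> a b; have [x <-] := coker_piP v.
by rewrite !coker_scaleE scalerDl coker_piD.
Qed.

HB.instance Definition _ := GRing.Zmodule_isLmodule.Build S coker_mod
  coker_scaleA coker_scale1 coker_scaleDr coker_scaleDl.

Lemma cokernel_exists :
  exists (Q : lmodType S) (p : {linear N -> Q}), surjective p /\ exact_at f p.
Proof.
have [|p pE] := @linear_map_of S N coker_mod pi.
  by move=> a x y; rewrite coker_piD -coker_scaleE.
exists coker_mod, p; split=> [y|y]; first by have [x <-] := coker_piP y; exists x.
rewrite -(linear0 p) !pE coker_piE subr0.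
by split=> [/asboolP|h]; last exact/asboolP.
Qed.

End Cokernel.

(** * The horseshoe lemma *)

Section Projectives.
Variable S : comNzRingType.
Implicit Types M N L P Q : lmodType S.

Lemma exact_at_comp0 M N L (f : {linear M -> N}) (g : {linear N -> L}) x :
  exact_at f g -> g (f x) = 0.
Proof. by move=> e; apply/e; exists x. Qed.

(** Both [f] and [t] factor through the kernel [K] of [g]. By exactness the factor of [f] is onto
    [K], so projectivity of [P] applies to it. *)
Lemma projective_lift_exact P M N L (f : {linear M -> N}) (g : {linear N -> L})
    (t : {linear P -> N}) :
    projective P -> exact_at f g -> (forall x, g (t x) = 0) ->
  exists h : {linear P -> M}, forall x, f (h x) = t x.
Proof.
move=> Pproj fg gt; have [K [k [k_inj kg]]] := kernel_exists g.
have [|f' f'E] := @lift_injective _ _ _ _ k f k_inj.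
  by move=> x; apply/kg; exact: exact_at_comp0.
have [|t' t'E] := @lift_injective _ _ _ _ k t k_inj.
  by move=> x; apply/kg.
have f'_surj : surjective f'.
  move=> y; have [x fx] := (fg (k y)).1 ((kg (k y)).2 (ex_intro _ y erefl)).
  by exists x; apply: k_inj; rewrite f'E.
have [h hE] := Pproj _ _ f' t' f'_surj.
by exists h => x; rewrite -t'E -hE -f'E.
Qed.

Lemma projective_prod P Q :
  projective P -> projective Q -> projective (P * Q)%type.
Proof.
move=> Pproj Qproj M N g f g_surj.
have [i iE] := linear_col (idfun : {linear P -> P}) (\0 : {linear P -> Q}).
have [j jE] := linear_col (\0 : {linear Q -> P}) (idfun : {linear Q -> Q}).
have [h1 h1E] := Pproj _ _ g (f \o i) g_surj.
have [h2 h2E] := Qproj _ _ g (f \o j) g_surj.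
have [h hE] := linear_row h1 h2.
exists h => -[x y] /=; rewrite hE linearD /=.
have /= -> := h1E x; have /= -> := h2E y.
by rewrite -linearD iE jE; congr (f _); congr pair; rewrite ?addr0 ?add0r.
Qed.

End Projectives.

Section Horseshoe.
Variables (S : comNzRingType) (A B C : lmodType S).
Variables (i : {linear A -> B}) (p : {linear B -> C}).
Hypothesis ip : short_exact_mod i p.
Variables (P : projective_resolution A) (Q : projective_resolution C).

Local Notation dP := (@res_diff S A P).
Local Notation dQ := (@res_diff S C Q).

Lemma res_diffK (M : lmodType S) (R : projective_resolution M) n x :
  res_diff R n (res_diff R n.+1 x) = 0.
Proof. exact: exact_at_comp0 (@res_exact S _ R n). Qed.

Lemma res_augK (M : lmodType S) (R : projective_resolution M) x :
  res_aug R (res_diff R 0 x) = 0.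
Proof. exact: exact_at_comp0 (@res_exact0 S _ R). Qed.

(** The horseshoe resolution of [B] has terms [P n * Q n], augmentation [i \o res_aug P] plus [s],
    and a triangular differential with diagonal [dP], [dQ] and off-diagonal entry [th]. The last two
    equations say that consecutive maps compose to zero. *)
Lemma horseshoe_twist :
  exists (s : {linear res_mod Q 0 -> B})
         (th : forall n, {linear res_mod Q n.+1 -> res_mod P n}),
  [/\ forall y, p (s y) = res_aug Q y,
      forall y, i (res_aug P (th 0 y)) = - s (dQ 0 y)
    & forall n y, dP n (th n.+1 y) = - th n (dQ n.+1 y)].
Proof.
have [i_inj ipE p_surj] := ip.
have [s sE] := res_proj (res_aug Q) p_surj.
have {}sE y : p (s y) = res_aug Q y by exact: sE.
(* The invariant of the recursion: [th \o dQ n.+1] is killed by the map leaving [res_mod P n], so it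
   lifts through [dP n]. That map is the augmentation when [n = 0], hence the case split. *)
pose good n : {linear res_mod Q n.+1 -> res_mod P n} -> Prop :=
  match n with
  | 0 => fun th => forall y, res_aug P (th (dQ 1 y)) = 0
  | m.+1 => fun th => forall y, dP m (th (dQ m.+2 y)) = 0
  end.
(* Since [res_aug P] is onto, [i \o res_aug P] has the same image as [i], namely the kernel of [p];
   so [- s \o dQ 0] lifts through it. *)
have [||th0 th0E] := @projective_lift_exact _ _ _ _ _
    (i \o res_aug P) p (\- (s \o dQ 0)) (@res_proj _ _ Q 1).
- move=> y; rewrite ipE; split=> [[a <-]|[x <-]]; last by exists (res_aug P x).
  by have [x <-] := res_aug_surj P a; exists x.
- by move=> y /=; rewrite linearN sE res_augK oppr0.
have good0 : good 0%N th0.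
  move=> y; apply: i_inj; have /= -> := th0E (dQ 1 y).
  by rewrite res_diffK !linear0.
(* Carrying [good] in a sigma type lets the chosen lifts be iterated by the fixpoint [th]. *)
have step n (u : {th | good n th}) : {v : {th | good n.+1 th} |
    forall y, dP n (sval v y) = - sval u (dQ n.+1 y)}.
  apply: cid; case: u => th thg /=.
  have [th' th'E] : exists th' : {linear res_mod Q n.+2 -> res_mod P n.+1},
      forall y, dP n (th' y) = (\- (th \o dQ n.+1)) y.
  - case: n th thg => [|n] th thg.
      apply: (projective_lift_exact (res_proj (i := 2)) (@res_exact0 S _ P)) => y /=.
      by rewrite linearN thg oppr0.
    apply: (projective_lift_exact (res_proj (i := n.+3)) (@res_exact S _ P n)) => y /=.
    by rewrite linearN thg oppr0.
  have th'g : good n.+1 th' by move=> y; rewrite th'E /= res_diffK linear0 oppr0.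
  by exists (exist _ th' th'g).
pose th := fix th n : {t | good n t} :=
  match n with 0 => exist _ th0 good0 | m.+1 => sval (step m (th m)) end.
exists s, (fun n => sval (th n)); split=> // n y.
exact: (svalP (step n (th n))).
Qed.

(** After the resolution is built, a cocycle on [P n * Q n] is bounded in two stages: first on the
    [P] summand, then on the [Q] summand after subtracting what the twist [th] contributes. *)
Lemma horseshoe n :
    (1 <= n)%N ->
    (forall f : {linear res_mod P n -> S^o}, cocycle f -> coboundary f) ->
    (forall f : {linear res_mod Q n -> S^o}, cocycle f -> coboundary f) ->
  Ext_eq0 n B S^o.
Proof.
have [i_inj ipE p_surj] := ip.
have [s [th [sE th0E thE]]] := horseshoe_twist.
pose R k : lmodType S := (res_mod P k * res_mod Q k)%type.
have /all_sig[d dE] k : {d : {linear R k.+1 -> R k} |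
    forall x, d x = (dP k x.1 + th k x.2, dQ k x.2)}.
  apply: cid; apply: linear_map_of => a x y /=.
  by rewrite !linearP addrACA -scalerDr.
have [e eE] := linear_row (i \o res_aug P) s.
have R_proj k : projective (R k) by apply: projective_prod; exact: res_proj.
have e_surj : surjective e.
  move=> b; have [y yE] := res_aug_surj Q (p b).
  have [|a aE] := (ipE (b - s y)).1; first by rewrite linearB sE yE subrr.
  by have [x xE] := res_aug_surj P a; exists (x, y); rewrite eE /= xE aE subrK.
(* Given a cycle [(x, y)], lift [y] to [y'] along [dQ]; then [x - th y'] is a cycle of [P] and lifts
   to [x']. The same correction gives [ex] in higher degrees. *)
have ex0 : exact_at (d 0%N) e.
  move=> [x y]; rewrite eE /=; split=> [exy|[[x' y'] xyE]].
    have /(@res_exact0 S _ Q)[y' y'E] : res_aug Q y = 0.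
      rewrite -sE -[s y](addKr (i (res_aug P x))) exy addr0 linearN.
      by rewrite (exact_at_comp0 _ ipE) oppr0.
    have /(@res_exact0 S _ P)[x' x'E] : res_aug P (x - th 0%N y') = 0.
      by apply: i_inj; rewrite !linear0 !linearB /= th0E opprK y'E.
    by exists (x', y'); rewrite dE /= x'E y'E subrK.
  move: xyE; rewrite dE => -[<- <-].
  by rewrite !linearD /= th0E res_augK linear0 add0r addNr.
have ex k : exact_at (d k.+1) (d k).
  move=> [x y]; rewrite dE /=; split=> [[xyE yE]|[[x' y'] xyE]].
    have /(@res_exact S _ Q _)[y' y'E] := yE.
    have /(@res_exact S _ P _)[x' x'E] : dP k (x - th k.+1 y') = 0.
      by rewrite linearB thE opprK y'E.
    by exists (x', y'); rewrite dE /= x'E y'E subrK.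
  move: xyE; rewrite dE => -[<- <-] /=.
  by rewrite linearD /= thE !res_diffK add0r addNr.
case: n => // n _ HP HQ; exists (ProjectiveResolution R_proj e_surj ex0 ex).
move=> f /= fd.
have [inl inlE] := linear_col (idfun : {linear res_mod P n.+1 -> _})
  (\0 : {linear _ -> res_mod Q n.+1}).
have [inr inrE] := linear_col (\0 : {linear _ -> res_mod P n.+1})
  (idfun : {linear res_mod Q n.+1 -> _}).
have fE x y : f (x, y) = f (inl x) + f (inr y).
  by rewrite -linearD inlE inrE; congr (f _); congr pair; rewrite ?addr0 ?add0r.
have [|g1 g1E] := HP (f \o inl).
  by move=> x /=; have /= := fd (x, 0); rewrite dE /= !linear0 addr0 inlE.
(* The functional [f] on [Q n.+1] is not itself a cocycle: along [dQ] it leaves the term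
   [g1 (dP n (th n.+1 y))] with a sign. Subtracting [g1 \o th n] cancels this term, by the
   anticommutation of [th]. *)
have [|g2 g2E] := HQ ((f \o inr) \+ (\- (g1 \o th n))).
  move=> y /=; have /= := fd (0, y); rewrite dE /= linear0 add0r fE.
  have /= -> := g1E (th n.+1 y).
  by rewrite thE linearN addrC.
have [g gE] := linear_row g1 g2; exists g => -[x y] /=.
rewrite dE gE /= linearD /=; have /= <- := g2E y; have /= <- := g1E x.
by rewrite fE -addrA [g1 _ + _]addrC subrK.
Qed.

End Horseshoe.

(** * Extensions of Gorenstein projective modules *)

Section DualMap.
Variables (S : comNzRingType) (M N : lmodType S) (f : {linear M -> N}).

Definition dual_map (g : dual N) : dual M :=
  ((g : {linear N -> S^o}) \o f : {linear M -> S^o}).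

Fact dual_map_is_linear : linear dual_map.
Proof. by move=> a g h; apply: linear_ext. Qed.
HB.instance Definition _ :=
  GRing.isLinear.Build S (dual N) (dual M) *:%R dual_map dual_map_is_linear.

End DualMap.

Lemma biduality_natural (S : comNzRingType) (M N : lmodType S)
    (f : {linear M -> N}) x :
  biduality (f x) = dual_map (dual_map f) (biduality x).
Proof. exact: linear_ext. Qed.

Lemma bijective_inj_surj (T U : Type) (f : T -> U) :
  bijective f <-> injective f /\ surjective f.
Proof.
split=> [[g fK gK]|[f_inj /choice[g gK]]].
  by split=> [|y]; [exact: can_inj fK | exists (g y)].
by exists g => // x; apply: f_inj; rewrite gK.
Qed.

Section Extension.
Variables (S : comNzRingType) (A B C : lmodType S).
Variables (i : {linear A -> B}) (p : {linear B -> C}).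
Hypothesis ip : short_exact_mod i p.

Lemma finitely_generated_extension :
  finitely_generated A -> finitely_generated C -> finitely_generated B.
Proof.
have [i_inj ipE p_surj] := ip.
move=> [k [g gA]] [l [h hC]].
have /choice[h' h'E] u : exists b, p b = h u by exact: p_surj.
exists (k + l)%N, (fun u => match split u with inl a => i (g a) | inr c => h' c end).
move=> x; have [c cE] := hC (p x).
have [|a aE] := (ipE (x - \sum_u c u *: h' u)).1.
  rewrite linearB linear_sum cE; apply/eqP; rewrite subr_eq0; apply/eqP.
  by apply: eq_bigr => u _; rewrite linearZ /= h'E.
have [d dE] := gA a.
exists (fun u => match split u with inl a => d a | inr v => c v end).
rewrite big_split_ord /= -[x in LHS](subrK (\sum_u c u *: h' u)) -aE dE linear_sum.
congr (_ + _); apply: eq_bigr => u _; first by rewrite (unsplitK (inl u)) linearZ.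
by rewrite (unsplitK (inr u)).
Qed.

(* The resolutions witnessing [Ext_eq0] may depend on [n], so the horseshoe is
   applied separately in each degree. *)
Lemma Ext_extension n :
  (1 <= n)%N -> Ext_eq0 n A S^o -> Ext_eq0 n C S^o -> Ext_eq0 n B S^o.
Proof. by move=> n_gt0 [P HP] [Q HQ]; exact: (horseshoe ip n_gt0 HP HQ). Qed.

(** With [s] lifting the augmentation of [Q] to [B], the map [s \o res_diff Q 0] factors through [i]
    as [g]. The cocycle [f \o g] bounds some [h], and every element of [B] has the form [i a + s q],
    so one can set [F (i a + s q) = f a + h q]. *)
Lemma extend_functional (f : {linear A -> S^o}) :
  Ext_eq0 1 C S^o -> exists F : {linear B -> S^o}, forall a, F (i a) = f a.
Proof.
have [i_inj ipE p_surj] := ip; move=> [Q HQ].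
have [s sE] := res_proj (res_aug Q) p_surj.
have {}sE y : p (s y) = res_aug Q y by exact: sE.
have [|g gE] := @lift_injective _ _ _ _ i (s \o res_diff Q 0) i_inj.
  by move=> y; apply/ipE; rewrite /= sE res_augK.
have [|h hE] := HQ (f \o g).
  move=> y /=; suff -> : g (res_diff Q 1 y) = 0 by rewrite linear0.
  by apply: i_inj; rewrite gE /= res_diffK !linear0.
have [b|v|a x x' v v'|F FE] := @linear_relation _ B S^o
  (fun b v => exists a q, b = i a + s q /\ v = f a + h q).
- have [q qE] := res_aug_surj Q (p b).
  have [|a aE] := (ipE (b - s q)).1; first by rewrite linearB sE qE subrr.
  by exists (f a + h q), a, q; rewrite aE subrK.
(* Well-definedness: if [i a + s q = 0], then [q] is the boundary of some [r], so [a = - g r] and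
   the two terms [f a] and [h q] cancel. *)
- move=> [a [q [e ->]]].
  have /(@res_exact0 S _ Q)[r rE] : res_aug Q q = 0.
    by rewrite -sE -[s q](addKr (i a)) -e addr0 linearN (exact_at_comp0 _ ipE) oppr0.
  have -> : a = - g r.
    apply: i_inj; rewrite linearN gE /= rE; apply/eqP.
    by rewrite -subr_eq0 opprK -e.
  by have /= hr := hE r; rewrite linearN hr rE addNr.
- move=> [b [q [-> ->]]] [b' [q' [-> ->]]]; exists (a *: b + b'), (a *: q + q').
  by rewrite !linearP !scalerDr; split; rewrite addrACA.
- by exists F => a; apply: FE; exists a, 0; rewrite !linear0 !addr0.
Qed.

(** Dualizing is left exact; surjectivity on the right is the extension of functionals from [A] to
    [B]. *)
Lemma dual_short_exact :
  Ext_eq0 1 C S^o -> short_exact_mod (dual_map p) (dual_map i).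
Proof.
have [i_inj ipE p_surj] := ip; move=> extC; split.
- move=> g h gh; apply: linear_ext => c; have [b <-] := p_surj c.
  exact: (congr1 (fun F : {linear B -> S^o} => F b) gh).
- move=> g; split=> [gi|[h <-]]; last first.
    by apply: linear_ext => a; rewrite /= (exact_at_comp0 _ ipE) linear0.
  have [|h hE] := @factor_surjective _ _ _ _ p (g : {linear B -> S^o}) p_surj.
    move=> b /ipE[a <-].
    exact: (congr1 (fun F : {linear A -> S^o} => F a) gi).
  by exists h; apply: linear_ext.
- move=> f; have [F FE] := extend_functional f extC.
  by exists F; apply: linear_ext.
Qed.

End Extension.

Lemma short_five (S : comNzRingType) (A B C A' B' C' : lmodType S)
    (i : {linear A -> B}) (p : {linear B -> C})
    (i' : {linear A' -> B'}) (p' : {linear B' -> C'})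
    (a : {linear A -> A'}) (b : {linear B -> B'}) (c : {linear C -> C'}) :
    short_exact_mod i p -> short_exact_mod i' p' ->
    (forall x, b (i x) = i' (a x)) -> (forall x, c (p x) = p' (b x)) ->
  bijective a -> bijective c -> bijective b.
Proof.
move=> [i_inj ip p_surj] [i'_inj ip' p'_surj] bi cp.
move=> /bijective_inj_surj[a_inj a_surj] /bijective_inj_surj[c_inj c_surj].
apply/bijective_inj_surj; split=> [|y].
  apply: linear_inj => x bx; have /ip[z zE] : p x = 0.
    by apply: c_inj; rewrite cp bx !linear0.
  rewrite -zE; suff -> : z = 0 by rewrite linear0.
  by apply: a_inj; apply: i'_inj; rewrite -bi zE bx !linear0.
have [z zE] := c_surj (p' y); have [x xE] := p_surj z.
have [|w wE] := (ip' (y - b x)).1; first by rewrite linearB -cp xE zE subrr.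
have [v vE] := a_surj w.
by exists (i v + x); rewrite linearD bi vE wE subrK.
Qed.

Lemma gorenstein_projective_extension (S : comNzRingType) (A B C : lmodType S)
    (i : {linear A -> B}) (p : {linear B -> C}) :
    short_exact_mod i p ->
  gorenstein_projective A -> gorenstein_projective C -> gorenstein_projective B.
Proof.
move=> ip [fgA extA extA' bidA] [fgC extC extC' bidC].
have ip' := dual_short_exact ip (extC 1%N isT).
(* The roles of the outer terms are exchanged: the dual sequence ends in [dual A], so the vanishing
   of Ext for [dual A] makes the bidual sequence exact. *)
have ip'' := dual_short_exact ip' (extA' 1%N isT).
split.
- exact: finitely_generated_extension ip fgA fgC.
- by move=> n n_gt0; apply: (Ext_extension ip) => //; [exact: extA|exact: extC].
- by move=> n n_gt0; apply: (Ext_extension ip') => //; [exact: extC'|exact: extA'].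
- apply: (short_five ip ip'' _ _ bidA bidC)  => x.
  exact: biduality_natural.
  exact: (biduality_natural p x).
Qed.

(** A zero module is projective and resolves itself: the constant complex with identity
    differentials is exact, as all its maps vanish. *)
Lemma Ext_trivial (S : comNzRingType) (M N : lmodType S) n :
  (forall x : M, x = 0) -> Ext_eq0 n M N.
Proof.
move=> M0.
have Mproj : projective M.
  by move=> U V g f _; exists \0 => x; rewrite /= (M0 x) !linear0.
have M_surj : surjective (idfun : {linear M -> M}) by move=> x; exists x.
have M_exact (f g : {linear M -> M}) : exact_at f g.
  by move=> x; rewrite (M0 (g x)); split=> // _; exists 0; rewrite [RHS]M0 [LHS]M0.
exists (@ProjectiveResolution S M (fun=> M) (fun=> idfun) idfun (fun=> Mproj)
  M_surj (M_exact _ _) (fun=> M_exact _ _)).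
case: n => [|n] f _ /=; first by move=> x; rewrite (M0 x) linear0.
by exists \0 => x; rewrite (M0 x) linear0.
Qed.

Lemma gorenstein_projective_trivial (S : comNzRingType) (M : lmodType S) :
  (forall x : M, x = 0) -> gorenstein_projective M.
Proof.
move=> M0; have M0' (f : dual M) : f = 0.
  by apply: linear_ext => x; rewrite (M0 x) !linear0.
split.
- exists 0%N, (fun=> 0) => x; exists (fun=> 0).
  by rewrite big_ord0; exact: M0.
- by move=> n _; exact: Ext_trivial.
- by move=> n _; exact: Ext_trivial.
- exists (fun=> 0) => [x|f]; first by rewrite [RHS]M0.
  by apply: linear_ext => g; rewrite (M0' g) !linear0.
Qed.

(** * Gorenstein projective kernels and cokernels *)

Section GorensteinMonicEpic.
Variable S : comNzRingType.
Implicit Types A B C T : lmodType S.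

(** The condition satisfied by each component of an admissible epic; [short_exact_mod] also makes
    [p] surjective. *)
Definition gp_kernel B C (p : {linear B -> C}) : Prop :=
  exists (A : lmodType S) (i : {linear A -> B}),
    gorenstein_projective A /\ short_exact_mod i p.

Definition gp_cokernel A B (i : {linear A -> B}) : Prop :=
  exists (C : lmodType S) (p : {linear B -> C}),
    gorenstein_projective C /\ short_exact_mod i p.

Lemma gp_kernel_id A : gp_kernel (idfun : {linear A -> A}).
Proof.
exists 'rV[S]_0, \0; split.
  by apply: gorenstein_projective_trivial => x; exact: thinmx0.
split=> [x y _|y|y]; first by rewrite [x]thinmx0 [y]thinmx0.
  by split=> [/= ->|[x <-]] //; exists 0.
by exists y.
Qed.

Lemma gp_cokernel_id A : gp_cokernel (idfun : {linear A -> A}).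
Proof.
exists 'rV[S]_0, \0; split.
  by apply: gorenstein_projective_trivial => x; exact: thinmx0.
split=> // [y|y]; first by split=> // _; exists y.
by exists 0; rewrite [RHS]thinmx0.
Qed.

(** The kernel of the composite is an extension of the kernel of [q] by the kernel of [p]. *)
Lemma gp_kernel_comp A B C (p : {linear A -> B}) (q : {linear B -> C}) :
  gp_kernel p -> gp_kernel q -> gp_kernel (q \o p).
Proof.
move=> [K [k [gpK [k_inj kp p_surj]]]] [L [l [gpL [l_inj lq q_surj]]]].
have [M [m [m_inj mqp]]] := kernel_exists (q \o p).
have [|u uE] := @lift_injective _ _ _ _ m k m_inj.
  by move=> x; apply/mqp; rewrite /= (exact_at_comp0 _ kp) linear0.
have [|v vE] := @lift_injective _ _ _ _ l (p \o m) l_inj.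
  by move=> x; apply/lq; exact: (exact_at_comp0 x mqp).
have uv : short_exact_mod u v.
  split=> [x y /(congr1 m)|x|z]; first by rewrite !uE => /k_inj.
    split=> [vx|[y <-]].
      have [|y yE] := (kp (m x)).1; first by have /= <- := vE x; rewrite vx linear0.
      by exists y; apply: m_inj; rewrite uE.
    by apply: l_inj; rewrite vE /= uE (exact_at_comp0 _ kp) linear0.
  have [x xE] := p_surj (l z).
  have [|y yE] := (mqp x).1; first by rewrite /= xE (exact_at_comp0 _ lq).
  by exists y; apply: l_inj; rewrite vE /= yE.
exists M, m; split; first exact: gorenstein_projective_extension uv gpK gpL.
split=> // z; have [y yE] := q_surj z; have [x xE] := p_surj y.
by exists x; rewrite /= xE.
Qed.

(** The cokernel of the composite is an extension of the cokernel of [j] by the cokernel of [i]. *)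
Lemma gp_cokernel_comp A B C (i : {linear A -> B}) (j : {linear B -> C}) :
  gp_cokernel i -> gp_cokernel j -> gp_cokernel (j \o i).
Proof.
move=> [P [p [gpP [i_inj ip p_surj]]]] [Q [q [gpQ [j_inj jq q_surj]]]].
have [R [r [r_surj jir]]] := cokernel_exists (j \o i).
have [|u uE] := @factor_surjective _ _ _ _ p (r \o j) p_surj.
  by move=> b /ip[a <-]; exact: (exact_at_comp0 a jir).
have [|v vE] := @factor_surjective _ _ _ _ r q r_surj.
  by move=> c /jir[a <-]; exact: exact_at_comp0 jq.
have uv : short_exact_mod u v.
  split=> [|x|z].
  - apply: linear_inj => x; have [b <-] := p_surj x; rewrite uE => /jir[a].
    by move=> /j_inj <-; exact: exact_at_comp0 ip.
  - split=> [|[y <-]].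
      have [c <-] := r_surj x; rewrite vE => /jq[b <-].
      by exists (p b); rewrite uE.
    by have [b <-] := p_surj y; rewrite uE /= vE (exact_at_comp0 _ jq).
  - by have [c <-] := q_surj z; exists (r c); rewrite vE.
exists R, r; split; first exact: gorenstein_projective_extension uv gpP gpQ.
by split=> // x y /j_inj/i_inj.
Qed.

(** Pushouts of modules in elementwise form: the three clauses express exactness of
    [A -> A' * B -> B' -> 0] with first map [(f, - i)], which suits diagram chases. *)
Definition mod_pushout A B A' B' (i : {linear A -> B}) (f : {linear A -> A'})
    (i' : {linear A' -> B'}) (f' : {linear B -> B'}) : Prop :=
  [/\ forall a, i' (f a) = f' (i a),
      forall b', exists a' b, b' = i' a' + f' b
    & forall a' b, i' a' + f' b = 0 -> exists a, f a = a' /\ i a = - b].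

Lemma mod_pushout_exists A B A' (i : {linear A -> B}) (f : {linear A -> A'}) :
  exists (B' : lmodType S) (i' : {linear A' -> B'}) (f' : {linear B -> B'}),
    mod_pushout i f i' f'.
Proof.
have [h hE] := linear_col f (\- i).
have [B' [q [q_surj hq]]] := cokernel_exists h.
have [inl inlE] := linear_col (idfun : {linear A' -> A'}) (\0 : {linear A' -> B}).
have [inr inrE] := linear_col (\0 : {linear B -> A'}) (idfun : {linear B -> B}).
have qE a b : q (inl a) + q (inr b) = q (a, b).
  by rewrite -linearD inlE inrE; congr (q _); congr pair; rewrite ?addr0 ?add0r.
exists B', (q \o inl), (q \o inr); split=> [a|b'|a' b] /=.
- apply/eqP; rewrite -subr_eq0 -linearN -linearN qE -hE; apply/eqP.
  exact: exact_at_comp0 hq.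
- by have [[a' b] <-] := q_surj b'; exists a', b; rewrite qE.
- rewrite qE => /hq[a]; rewrite hE => -[fa ia]; exists a.
  by rewrite -ia opprK.
Qed.

Lemma mod_pushout_universal A B A' B' T (i : {linear A -> B}) (f : {linear A -> A'})
    (i' : {linear A' -> B'}) (f' : {linear B -> B'})
    (s : {linear A' -> T}) (t : {linear B -> T}) :
    mod_pushout i f i' f' -> (forall a, s (f a) = t (i a)) ->
  exists u : {linear B' -> T}, (forall a, u (i' a) = s a) /\ (forall b, u (f' b) = t b).
Proof.
move=> [ff' joint ker] st.
have [b'|v|c x x' v v'|u uE] := @linear_relation _ B' T
  (fun b' v => exists a' b, b' = i' a' + f' b /\ v = s a' + t b).
- by have [a' [b ->]] := joint b'; exists (s a' + t b), a', b.
- move=> [a' [b [/esym/ker[a [<- ia]] ->]]].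
  by rewrite st ia linearN addNr.
- move=> [a [b [-> ->]]] [a' [b' [-> ->]]]; exists (c *: a + a'), (c *: b + b').
  by rewrite !linearP !scalerDr; split; rewrite addrACA.
- exists u; split=> x; apply: uE.
    by exists x, 0; rewrite !linear0 !addr0.
  by exists 0, x; rewrite !linear0 !add0r.
Qed.

(** A pushout keeps the cokernel: [p'] is induced by [\0] on [A'] and [p] on [B]. Thus [B'] is an
    extension of [C] by [A']. *)
Lemma mod_pushout_short_exact A B C A' B' (i : {linear A -> B}) (p : {linear B -> C})
    (f : {linear A -> A'}) (i' : {linear A' -> B'}) (f' : {linear B -> B'}) :
    short_exact_mod i p -> mod_pushout i f i' f' ->
  exists p' : {linear B' -> C}, short_exact_mod i' p'.
Proof.
move=> [i_inj ip p_surj] po; have [ff' joint ker] := po.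
have [|p' [p'i p'f]] := @mod_pushout_universal _ _ _ _ _ _ _ _ _ \0 p po.
  by move=> a; rewrite (exact_at_comp0 _ ip).
exists p'; split=> [|x|y].
- apply: linear_inj => a' i'a'.
  have [|a [<-]] := ker a' 0; first by rewrite i'a' linear0 addr0.
  by rewrite oppr0 -(linear0 i) => /i_inj ->; rewrite linear0.
- split=> [|[a' <-]]; last exact: p'i.
  have [a' [b ->]] := joint x; rewrite linearD p'i p'f add0r => /ip[a <-].
  by exists (a' + f a); rewrite linearD ff'.
- by have [b <-] := p_surj y; exists (f' b).
Qed.

(** Pullbacks of modules in elementwise form, that is, exactness of [0 -> B' -> C' * B -> C] with
    last map [f] minus [p]. *)
Definition mod_pullback B C B' C' (p : {linear B -> C}) (f : {linear C' -> C})
    (p' : {linear B' -> C'}) (f' : {linear B' -> B}) : Prop :=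
  [/\ forall x, f (p' x) = p (f' x),
      forall x, p' x = 0 -> f' x = 0 -> x = 0
    & forall c b, f c = p b -> exists x, p' x = c /\ f' x = b].

Lemma mod_pullback_exists B C C' (p : {linear B -> C}) (f : {linear C' -> C}) :
  exists (B' : lmodType S) (p' : {linear B' -> C'}) (f' : {linear B' -> B}),
    mod_pullback p f p' f'.
Proof.
have [h hE] := linear_row f (\- p).
have [B' [k [k_inj kh]]] := kernel_exists h.
exists B', (fst \o k), (snd \o k); split=> [x|x /= k1 k2|c b fc] /=.
- apply/eqP; rewrite -subr_eq0; apply/eqP.
  by have := exact_at_comp0 x kh; rewrite hE.
- by apply: k_inj; rewrite linear0 (surjective_pairing (k x)) k1 k2.
- have [|x xE] := (kh (c, b)).1; first by rewrite hE /= fc subrr.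
  by exists x; rewrite xE.
Qed.

Lemma mod_pullback_universal B C B' C' T (p : {linear B -> C}) (f : {linear C' -> C})
    (p' : {linear B' -> C'}) (f' : {linear B' -> B})
    (s : {linear T -> C'}) (t : {linear T -> B}) :
    mod_pullback p f p' f' -> (forall x, f (s x) = p (t x)) ->
  exists u : {linear T -> B'}, (forall x, p' (u x) = s x) /\ (forall x, f' (u x) = t x).
Proof.
move=> [pf joint lift] st.
have R x : exists y, p' y = s x /\ f' y = t x by exact: lift.
have [|v|a x x' v v'|u uE] := @linear_relation _ T B'
  (fun x y => p' y = s x /\ f' y = t x).
- exact: R.
- by rewrite !linear0 => -[]; exact: joint.
- by move=> [p1 f1] [p2 f2]; rewrite !linearP p1 p2 f1 f2.
- by exists u; split=> x; have [y yE] := R x; rewrite (uE _ _ yE); case: yE.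
Qed.

(** A pullback keeps the kernel: [i'] is induced by [\0] into [C'] and [i] into [B]. Thus [B'] is an
    extension of [C'] by [A]. *)
Lemma mod_pullback_short_exact A B C B' C' (i : {linear A -> B}) (p : {linear B -> C})
    (f : {linear C' -> C}) (p' : {linear B' -> C'}) (f' : {linear B' -> B}) :
    short_exact_mod i p -> mod_pullback p f p' f' ->
  exists i' : {linear A -> B'}, short_exact_mod i' p'.
Proof.
move=> [i_inj ip p_surj] pb; have [pf joint lift] := pb.
have [|i' [pi' fi']] := @mod_pullback_universal _ _ _ _ _ _ _ _ _ \0 i pb.
  by move=> a; rewrite linear0 (exact_at_comp0 _ ip).
exists i'; split=> [a a' /(congr1 f')|x|c]; first by rewrite !fi' => /i_inj.
  split=> [px|[a <-]]; last exact: pi'.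
  have /ip[a aE] : p (f' x) = 0 by rewrite -pf px linear0.
  exists a; apply/eqP; rewrite -subr_eq0; apply/eqP.
  by apply: joint; rewrite linearB ?pi' ?px ?fi' ?aE subrr.
have [b bE] := p_surj (f c); have [x [xE _]] := lift c b (esym bE).
by exists x.
Qed.

Lemma gorenstein_projective_prod A B :
  gorenstein_projective A -> gorenstein_projective B ->
  gorenstein_projective (A * B)%type.
Proof.
have [i iE] := linear_col (idfun : {linear A -> A}) (\0 : {linear A -> B}).
apply: (@gorenstein_projective_extension _ _ _ _ i snd); split.
- by move=> x y; rewrite !iE => -[].
- move=> [a b] /=; split=> [->|[x]]; first by exists a; rewrite iE.
  by rewrite iE => -[].
- by move=> b; exists (0, b).
Qed.

End GorensteinMonicEpic.

(** * The exact structure on Mon *)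

Section MonExact.
Variables (S : comNzRingType) (w : S).
Local Notation Mon := (Mon w).
Implicit Types A B X Y Z : Mon.

Local Notation map X := (mor_map (sval X)).

Lemma mor_hom_eqP (X Y : mor_obj S) (f g : mor_hom X Y) :
  f = g <-> hom_dom f =1 hom_dom g /\ hom_cod f =1 hom_cod g.
Proof. by split=> [->|[]]; [|exact: mor_hom_ext]. Qed.

(** The finite generation proofs that [MorObj] asks for are read off from the Gorenstein
    projectivity of the two modules. *)
Lemma in_Mon_MorObj (M1 M0 : lmodType S) (f : {linear M1 -> M0})
    (gp1 : gorenstein_projective M1) (gp0 : gorenstein_projective M0) :
    injective f -> (forall y, exists x, f x = w *: y) ->
  in_Mon w (@MorObj S M1 M0 f (let: And4 h _ _ _ := gp1 in h)
                              (let: And4 h _ _ _ := gp0 in h)).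
Proof. by []. Qed.

Definition mk_Mon (M1 M0 : lmodType S) (f : {linear M1 -> M0})
    (gp1 : gorenstein_projective M1) (gp0 : gorenstein_projective M0)
    (f_inj : injective f) (wf : forall y, exists x, f x = w *: y) : Mon :=
  exist _ _ (in_Mon_MorObj gp1 gp0 f_inj wf).

Lemma Mon_gp_dom X : gorenstein_projective (mor_dom (sval X)).
Proof. by case: (svalP X). Qed.
Lemma Mon_gp_cod X : gorenstein_projective (mor_cod (sval X)).
Proof. by case: (svalP X). Qed.
Lemma Mon_inj X : injective (map X).
Proof. by case: (svalP X). Qed.
Lemma Mon_w X y : exists x, map X x = w *: y.
Proof. by case: (svalP X) => _ _ _; apply. Qed.
Lemma Mon_comm X Y (f : mor_hom (sval X) (sval Y)) x :
  map Y (hom_dom f x) = hom_cod f (map X x).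
Proof. exact: hom_comm. Qed.

Local Notation E := (@Mon_conflation S w).

(** The factorisations are found componentwise. Their squares commute after composing with the
    injective [hom_cod i], respectively with the surjective [hom_dom p]. *)
Lemma Mon_kernel_cokernel_pair X Y Z (i : cat_hom X Y) (p : cat_hom Y Z) :
  E i p -> kernel_cokernel_pair i p.
Proof.
move=> [[i1_inj ip1 p1_surj] [i0_inj ip0 p0_surj]].
have pi0 : p \oc i = 0.
  by apply/mor_hom_eqP; split=> x; [exact: exact_at_comp0 ip1|exact: exact_at_comp0 ip0].
split; split=> // T t /mor_hom_eqP[/= t1 t0].
- have [|u1 u1E] := @lift_injective _ _ _ _ (hom_dom i) (hom_dom t) i1_inj.
    by move=> x; apply/ip1; exact: t1.
  have [|u0 u0E] := @lift_injective _ _ _ _ (hom_cod i) (hom_cod t) i0_inj.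
    by move=> x; apply/ip0; exact: t0.
  have uc : map X \o u1 =1 u0 \o map T.
    by move=> x; apply: i0_inj; rewrite /= u0E -!Mon_comm u1E.
  exists (MorHom uc); split; first by apply/mor_hom_eqP.
  move=> v /mor_hom_eqP[v1 v0]; apply/mor_hom_eqP.
  split=> x /=; first by apply: i1_inj; rewrite u1E -v1.
  by apply: i0_inj; rewrite u0E -v0.
- have [|u1 u1E] := @factor_surjective _ _ _ _ (hom_dom p) (hom_dom t) p1_surj.
    by move=> x /ip1[y <-]; exact: t1.
  have [|u0 u0E] := @factor_surjective _ _ _ _ (hom_cod p) (hom_cod t) p0_surj.
    by move=> x /ip0[y <-]; exact: t0.
  have uc : map T \o u1 =1 u0 \o map Z.
    by move=> z /=; have [y <-] := p1_surj z; rewrite u1E !Mon_comm u0E.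
  exists (MorHom uc); split; first by apply/mor_hom_eqP.
  move=> v /mor_hom_eqP[v1 v0]; apply/mor_hom_eqP.
  split=> z /=; first by have [y <-] := p1_surj z; rewrite u1E -v1.
  by have [y <-] := p0_surj z; rewrite u0E -v0.
Qed.

Lemma Mon_admissible_epicP X Y (p : cat_hom X Y) :
  admissible_epic E p <-> gp_kernel (hom_dom p) /\ gp_kernel (hom_cod p).
Proof.
split=> [[K [k [k1 k0]]]|[[K1 [k1 [gp1 ex1]]] [K0 [k0 [gp0 ex0]]]]].
  split; [exists (mor_dom (sval K)), (hom_dom k)|exists (mor_cod (sval K)), (hom_cod k)].
    by split=> //; exact: Mon_gp_dom.
  by split=> //; exact: Mon_gp_cod.
have [[k1_inj kp1 p1_surj] [k0_inj kp0 p0_surj]] := (ex1, ex0).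
have [|f fE] := @lift_injective _ _ _ _ k0 (map X \o k1) k0_inj.
  by move=> x; apply/kp0; rewrite /= -Mon_comm (exact_at_comp0 _ kp1) linear0.
have f_inj : injective f.
  by move=> x y /(congr1 k0); rewrite !fE => /Mon_inj/k1_inj.
(* A preimage [x] of [w *: k0 y] in the domain of [X] must lie in the kernel of [hom_dom p]: its
   image there vanishes after applying the injective structure map of [Y]. *)
have f_w y : exists x, f x = w *: y.
  have [x xE] := Mon_w (k0 y).
  have [|z zE] := (kp1 x).1.
    apply: Mon_inj.
    by rewrite Mon_comm xE linearZ /= (exact_at_comp0 _ kp0) scaler0 linear0.
  by exists z; apply: k0_inj; rewrite fE /= zE xE linearZ.
exists (mk_Mon gp1 gp0 f_inj f_w).
have kc : map X \o k1 =1 k0 \o f by move=> x /=; rewrite fE.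
by exists (@MorHom _ (sval (mk_Mon gp1 gp0 f_inj f_w)) (sval X) k1 k0 kc).
Qed.

(* The last clause says that Coker (i_1) -> Coker (i_0) is injective; without
   it the cokernel of i in Mor leaves Mon. *)
Lemma Mon_admissible_monicP X Y (i : cat_hom X Y) :
  admissible_monic E i <->
  [/\ gp_cokernel (hom_dom i), gp_cokernel (hom_cod i)
    & forall b a, map Y b = hom_cod i a -> exists a', hom_dom i a' = b].
Proof.
split=> [[Q [q [ex1 ex0]]]|[[Q1 [q1 [gp1 ex1]]] [Q0 [q0 [gp0 ex0]]] inQ]].
  have [[_ iq1 _] [_ iq0 _]] := (ex1, ex0); split.
  - by exists (mor_dom (sval Q)), (hom_dom q); split=> //; exact: Mon_gp_dom.
  - by exists (mor_cod (sval Q)), (hom_cod q); split=> //; exact: Mon_gp_cod.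
  - move=> b a ba; apply/iq1; apply: Mon_inj.
    by rewrite Mon_comm ba (exact_at_comp0 _ iq0) linear0.
have [[i1_inj iq1 q1_surj] [i0_inj iq0 q0_surj]] := (ex1, ex0).
have [|f fE] := @factor_surjective _ _ _ _ q1 (q0 \o map Y) q1_surj.
  by move=> x /iq1[a <-]; rewrite /= Mon_comm (exact_at_comp0 _ iq0).
have f_inj : injective f.
  apply: linear_inj => z; have [b <-] := q1_surj z; rewrite fE => /iq0[a aE].
  by have [a' <-] := inQ b a (esym aE); exact: exact_at_comp0 iq1.
have f_w z : exists x, f x = w *: z.
  have [b <-] := q0_surj z; have [x xE] := Mon_w b.
  by exists (q1 x); rewrite fE /= xE linearZ.
exists (mk_Mon gp1 gp0 f_inj f_w).
have qc : f \o q1 =1 q0 \o map Y by move=> x /=; rewrite fE.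
by exists (@MorHom _ (sval Y) (sval (mk_Mon gp1 gp0 f_inj f_w)) q1 q0 qc).
Qed.

(** * Additivity and closure under isomorphism *)

Lemma Mon_zero_object : exists Z : Mon, zero_object Z.
Proof.
have gp : gorenstein_projective ('rV[S]_0 : lmodType S).
  by apply: gorenstein_projective_trivial => x; exact: thinmx0.
have f_inj : injective (idfun : {linear 'rV[S]_0 -> 'rV[S]_0}) by [].
have f_w (y : 'rV[S]_0) : exists x, idfun x = w *: y by exists (w *: y).
exists (mk_Mon gp gp f_inj f_w) => A; split=> f; apply/mor_hom_eqP; split=> x /=.
- by rewrite [LHS]thinmx0 [RHS]thinmx0.
- by rewrite [LHS]thinmx0 [RHS]thinmx0.
- by rewrite [x]thinmx0 linear0.
- by rewrite [x]thinmx0 linear0.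
Qed.

Lemma Mon_biproduct A B :
  exists P (i1 : cat_hom A P) (i2 : cat_hom B P)
         (p1 : cat_hom P A) (p2 : cat_hom P B), biproduct i1 i2 p1 p2.
Proof.
have gp1 := gorenstein_projective_prod (Mon_gp_dom A) (Mon_gp_dom B).
have gp0 := gorenstein_projective_prod (Mon_gp_cod A) (Mon_gp_cod B).
have [f fE] := linear_col (map A \o fst : {linear (_ * mor_dom (sval B))%type -> _})
  (map B \o snd : {linear (mor_dom (sval A) * _)%type -> _}).
have f_inj : injective f.
  by move=> [a b] [a' b']; rewrite !fE => -[/Mon_inj /= -> /Mon_inj /= ->].
have f_w y : exists x, f x = w *: y.
  have [a aE] := Mon_w y.1; have [b bE] := Mon_w y.2.
  by exists (a, b); rewrite fE /= aE bE.
pose P := mk_Mon gp1 gp0 f_inj f_w.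
have [l1 l1E] := linear_col (idfun : {linear mor_dom (sval A) -> _})
  (\0 : {linear _ -> mor_dom (sval B)}).
have [l0 l0E] := linear_col (idfun : {linear mor_cod (sval A) -> _})
  (\0 : {linear _ -> mor_cod (sval B)}).
have [r1 r1E] := linear_col (\0 : {linear _ -> mor_dom (sval A)})
  (idfun : {linear mor_dom (sval B) -> _}).
have [r0 r0E] := linear_col (\0 : {linear _ -> mor_cod (sval A)})
  (idfun : {linear mor_cod (sval B) -> _}).
have lc : map P \o l1 =1 l0 \o map A.
  by move=> x /=; rewrite fE l1E l0E /= linear0.
have rc : map P \o r1 =1 r0 \o map B.
  by move=> x /=; rewrite fE r1E r0E /= linear0.
have pc : map A \o fst =1 fst \o map P by move=> x /=; rewrite fE.
have qc : map B \o snd =1 snd \o map P by move=> x /=; rewrite fE.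
exists P, (@MorHom _ (sval A) (sval P) l1 l0 lc), (@MorHom _ (sval B) (sval P) r1 r0 rc),
  (@MorHom _ (sval P) (sval A) fst fst pc), (@MorHom _ (sval P) (sval B) snd snd qc).
split; apply/mor_hom_eqP; split=> x /=; rewrite ?l1E ?l0E ?r1E ?r0E //=.
  by case: x => x y; congr pair => /=; rewrite ?addr0 ?add0r.
by case: x => x y; congr pair => /=; rewrite ?addr0 ?add0r.
Qed.

Lemma Mon_iso_closed : iso_closed E.
Proof.
have iso_bij X Y (f : cat_hom X Y) : isomorphism f ->
    [/\ injective (hom_dom f), surjective (hom_dom f),
        injective (hom_cod f) & surjective (hom_cod f)].
  move=> [g [/mor_hom_eqP[gf1 gf0] /mor_hom_eqP[fg1 fg0]]]; split.
  - exact: (can_inj (gf1 : cancel (hom_dom f) (hom_dom g))).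
  - by move=> y; exists (hom_dom g y); exact: fg1.
  - exact: (can_inj (gf0 : cancel (hom_cod f) (hom_cod g))).
  - by move=> y; exists (hom_cod g y); exact: fg0.
(* Isomorphisms are bijective in both components, so closure reduces to carrying exactness of one
   row of modules along bijections. *)
have transport (M N L M' N' L' : lmodType S) (i : {linear M -> N})
    (p : {linear N -> L}) (i' : {linear M' -> N'}) (p' : {linear N' -> L'})
    (a : {linear M -> M'}) (b : {linear N -> N'}) (c : {linear L -> L'}) :
    surjective a -> injective b -> surjective b -> injective c -> surjective c ->
    (forall x, i' (a x) = b (i x)) -> (forall x, p' (b x) = c (p x)) ->
    short_exact_mod i p -> short_exact_mod i' p'.
  move=> a_surj b_inj b_surj c_inj c_surj ia pb [i_inj ip p_surj]; split.
  - move=> x y; have [x' <-] := a_surj x; have [y' <-] := a_surj y.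
    by rewrite !ia => /b_inj/i_inj ->.
  - move=> y; have [z <-] := b_surj y; rewrite pb; split=> [|[x]].
      rewrite -(linear0 c) => /c_inj/ip[x <-].
      by exists (a x); rewrite ia.
    have [x' <-] := a_surj x; rewrite ia => /b_inj <-.
    by rewrite (exact_at_comp0 _ ip) linear0.
  - move=> z; have [y <-] := c_surj z; have [x <-] := p_surj y.
    by exists (b x); rewrite pb.
move=> A B X A' B' X' i p i' p' a b x /iso_bij[_ a1 _ a0] /iso_bij[b1 b1' b0 b0'].
move=> /iso_bij[x1 x1' x0 x0'] /mor_hom_eqP[ia1 ia0] /mor_hom_eqP[pb1 pb0] [ex1 ex0].
split; [apply: (transport _ _ _ _ _ _ _ _ _ _ _ _ _ a1 b1 b1' x1 x1' _ _ ex1)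
       |apply: (transport _ _ _ _ _ _ _ _ _ _ _ _ _ a0 b0 b0' x0 x0' _ _ ex0)] => //.
Qed.

(** The pushout is formed in each component, with [g] the induced map between the two. The condition
    on cokernels from [Mon_admissible_monicP] is what makes [g] injective. *)
Lemma Mon_pushout A B A' (i : cat_hom A B) (f : cat_hom A A') :
  admissible_monic E i ->
  exists B' (i' : cat_hom A' B') (f' : cat_hom B B'),
    is_pushout i f i' f' /\ admissible_monic E i'.
Proof.
move=> /Mon_admissible_monicP[[X1 [p1 [gpX1 ex1]]] [X0 [p0 [gpX0 ex0]]] inX].
have [B1 [i1 [f1 po1]]] := mod_pushout_exists (hom_dom i) (hom_dom f).
have [B0 [i0 [f0 po0]]] := mod_pushout_exists (hom_cod i) (hom_cod f).
have [q1 ex1'] := mod_pushout_short_exact ex1 po1.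
have [q0 ex0'] := mod_pushout_short_exact ex0 po0.
have gp1 := gorenstein_projective_extension ex1' (Mon_gp_dom A') gpX1.
have gp0 := gorenstein_projective_extension ex0' (Mon_gp_cod A') gpX0.
have [sq1 joint1 ker1] := po1; have [sq0 joint0 ker0] := po0.
have [|g [gi gf]] := @mod_pushout_universal _ _ _ _ _ _ _ _ _ _
  (i0 \o map A') (f0 \o map B) po1.
  by move=> a; rewrite /= !Mon_comm sq0.
(* The central chase: an element of the upper pushout that [g] sends into the image of [i0] already
   comes from [A']. Taking [c = 0] gives injectivity of [g]; general [c] gives the cokernel
   condition for [i']. *)
have in_i a' b c : g (i1 a' + f1 b) = i0 c ->
    exists2 a, hom_dom i a = b & map A' (a' + hom_dom f a) = c.
  rewrite linearD gi gf /= => e.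
  have [|a [fa ia]] := ker0 (map A' a' - c) (map B b).
    by rewrite linearB addrAC e subrr.
  have [a1 a1E] : exists a1, hom_dom i a1 = b.
    by apply: (inX b (- a)); rewrite linearN ia opprK.
  exists a1 => //; have [i0_inj _ _] := ex0.
  have aE : a = - map A a1.
    by apply: i0_inj; rewrite ia -a1E Mon_comm linearN.
  apply/eqP; rewrite linearD Mon_comm -subr_eq0 addrAC -fa aE linearN.
  by rewrite addNr.
have g_inj : injective g.
  apply: linear_inj => x; have [a' [b ->]] := joint1 x => e.
  have [|a ia a'E] := in_i a' b 0; first by rewrite e linear0.
  rewrite -ia -sq1 -linearD.
  by rewrite (_ : _ + _ = 0) ?linear0 //; apply: Mon_inj; rewrite a'E linear0.
have g_w y : exists x, g x = w *: y.
  have [a' [b ->]] := joint0 y.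
  have [c cE] := Mon_w a'; have [d dE] := Mon_w b.
  by exists (i1 c + f1 d); rewrite linearD gi gf /= cE dE !linearZ scalerDr.
pose B' := mk_Mon gp1 gp0 g_inj g_w.
pose i' : mor_hom (sval A') (sval B') := @MorHom _ (sval A') (sval B') i1 i0 gi.
pose f' : mor_hom (sval B) (sval B') := @MorHom _ (sval B) (sval B') f1 f0 gf.
exists B', i', f'; split; last first.
  apply/Mon_admissible_monicP; split.
  - by exists X1, q1.
  - by exists X0, q0.
  - move=> b c /=; have [a' [d ->]] := joint1 b => /in_i[a <- _].
    by exists (a' + hom_dom f a); rewrite linearD sq1.
split; first by apply/mor_hom_eqP.
move=> T s t /mor_hom_eqP[st1 st0].
have [u1 [u1i u1f]] := mod_pushout_universal po1 st1.
have [u0 [u0i u0f]] := mod_pushout_universal po0 st0.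
have uc : map T \o u1 =1 u0 \o map B'.
  move=> x /=; have [a [b ->]] := joint1 x.
  by rewrite !linearD u1i u1f gi gf /= u0i u0f !Mon_comm.
exists (@MorHom _ (sval B') (sval T) u1 u0 uc); split.
  by split; apply/mor_hom_eqP.
move=> v [/mor_hom_eqP[vi1 vi0] /mor_hom_eqP[vf1 vf0]]; apply/mor_hom_eqP; split=> x /=.
  have [a [b ->]] := joint1 x; rewrite !linearD u1i u1f.
  by have /= <- := vi1 a; have /= <- := vf1 b.
have [a [b ->]] := joint0 x; rewrite !linearD u0i u0f.
by have /= <- := vi0 a; have /= <- := vf0 b.
Qed.

Lemma Mon_pullback B X X' (p : cat_hom B X) (f : cat_hom X' X) :
  admissible_epic E p ->
  exists B' (p' : cat_hom B' X') (f' : cat_hom B' B),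
    is_pullback p f p' f' /\ admissible_epic E p'.
Proof.
move=> /Mon_admissible_epicP[[K1 [k1 [gpK1 ex1]]] [K0 [k0 [gpK0 ex0]]]].
have [B1 [p1 [f1 pb1]]] := mod_pullback_exists (hom_dom p) (hom_dom f).
have [B0 [p0 [f0 pb0]]] := mod_pullback_exists (hom_cod p) (hom_cod f).
have [j1 ex1'] := mod_pullback_short_exact ex1 pb1.
have [j0 ex0'] := mod_pullback_short_exact ex0 pb0.
have gp1 := gorenstein_projective_extension ex1' gpK1 (Mon_gp_dom X').
have gp0 := gorenstein_projective_extension ex0' gpK0 (Mon_gp_cod X').
have [sq1 joint1 lift1] := pb1; have [sq0 joint0 lift0] := pb0.
have [|g [pg fg]] := @mod_pullback_universal _ _ _ _ _ _ _ _ _ _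
  (map X' \o p1) (map B \o f1) pb0.
  by move=> x; rewrite /= -!Mon_comm sq1.
have joint0' x y : p0 x = p0 y -> f0 x = f0 y -> x = y.
  move=> px fx; apply/eqP; rewrite -subr_eq0; apply/eqP.
  by apply: joint0; rewrite linearB ?px ?fx subrr.
(* The two projections of [B1] are jointly injective, and the structure maps of [X'] and [B] are
   injective. *)
have g_inj : injective g.
  apply: linear_inj => x gx; apply: joint1; apply: Mon_inj.
    by have /= <- := pg x; rewrite gx !linear0.
  by have /= <- := fg x; rewrite gx !linear0.
(* Preimages of [w *: p0 y] and [w *: f0 y] are chosen separately; they agree in the domain of [X]
   because its structure map is injective, so they glue to an element of [B1]. *)
have g_w y : exists x, g x = w *: y.
  have [c cE] := Mon_w (p0 y); have [d dE] := Mon_w (f0 y).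
  have [|x [pxE fxE]] := lift1 c d.
    by apply: Mon_inj; rewrite !Mon_comm cE dE !linearZ /= sq0.
  exists x; apply: joint0'; first by rewrite pg /= pxE cE linearZ.
  by rewrite fg /= fxE dE linearZ.
pose B' := mk_Mon gp1 gp0 g_inj g_w.
pose p' : mor_hom (sval B') (sval X') :=
  @MorHom _ (sval B') (sval X') p1 p0 (fun x => esym (pg x)).
pose f' : mor_hom (sval B') (sval B) :=
  @MorHom _ (sval B') (sval B) f1 f0 (fun x => esym (fg x)).
exists B', p', f'; split; last first.
  by apply/Mon_admissible_epicP; split; [exists K1, j1|exists K0, j0].
split; first by apply/mor_hom_eqP.
move=> T s t /mor_hom_eqP[st1 st0].
have [u1 [u1p u1f]] := mod_pullback_universal pb1 st1.
have [u0 [u0p u0f]] := mod_pullback_universal pb0 st0.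
have uc : map B' \o u1 =1 u0 \o map T.
  by move=> x; apply: joint0'; rewrite /= ?pg ?fg /= ?u1p ?u1f ?u0p ?u0f !Mon_comm.
exists (@MorHom _ (sval T) (sval B') u1 u0 uc); split.
  by split; apply/mor_hom_eqP.
move=> v [/mor_hom_eqP[vp1 vp0] /mor_hom_eqP[vf1 vf0]]; apply/mor_hom_eqP; split=> x /=.
  apply/eqP; rewrite -subr_eq0; apply/eqP; apply: joint1; rewrite linearB.
    by rewrite u1p; have /= <- := vp1 x; rewrite subrr.
  by rewrite u1f; have /= <- := vf1 x; rewrite subrr.
apply: joint0'; first by rewrite u0p; have /= <- := vp0 x.
by rewrite u0f; have /= <- := vf0 x.
Qed.

Lemma Mon_exact_category : exact_category E.
Proof.
split.
- split; [exact: Mon_zero_object|exact: Mon_biproduct].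
- exact: Mon_kernel_cokernel_pair.
- exact: Mon_iso_closed.
- move=> A; apply/Mon_admissible_monicP; split=> [||b a ba].
  + exact: gp_cokernel_id.
  + exact: gp_cokernel_id.
  + by exists b.
- move=> A; apply/Mon_admissible_epicP; split; exact: gp_kernel_id.
- move=> A B X i j /Mon_admissible_monicP[i1 i0 inA] /Mon_admissible_monicP[j1 j0 inB].
  apply/Mon_admissible_monicP; split.
  + exact: gp_cokernel_comp i1 j1.
  + exact: gp_cokernel_comp i0 j0.
  (* The cokernel condition is applied to [j] first; injectivity of [hom_cod j] then moves the
     resulting equation back to [B], where the condition for [i] applies. *)
  + move=> c a /= ca; have [b bE] := inB _ _ ca.
    have [_ [_ [_ [j0_inj _ _]]]] := j0.
    have [|a' a'E] := inA b a; last by exists a'; rewrite /= a'E.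
    by apply: j0_inj; rewrite -Mon_comm bE.
- move=> A B X p q /Mon_admissible_epicP[p1 p0] /Mon_admissible_epicP[q1 q0].
  apply/Mon_admissible_epicP; split.
  + exact: gp_kernel_comp p1 q1.
  + exact: gp_kernel_comp p0 q0.
- exact: Mon_pushout.
- exact: Mon_pullback.
Qed.

End MonExact.

Theorem theorem2p8 (S : comNzRingType) (n : set S) (w : S)
    (S_noetherian : noetherian_ring S) (S_local : local_ring n)
    (w_in_n : n w) (w_nonzerodivisor : GRing.lreg w) :
  exact_category (@Mon_conflation S w).
Proof. exact: Mon_exact_category. Qed.
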